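(* Let $r\geq 1$, let $\mathbf{f}=(f_0,f_1,\ldots,f_r)$ with each $f_j\in\mathcal{S}_1$, and let $\boldsymbol{\nu}=(\nu_0,\ldots,\nu_r)$ be a vector of pairwise distinct and pairwise coprime positive integers. Then $$\mathcal{R}_{\mathbf{f}}(\boldsymbol{\nu}) = -\Delta \mathbf{f} + \sum_{k=0}^{r} \nu_k \int_{0}^1 f_k'(\nu_k x)\prod_{j\neq k} f_j(\nu_j x)\, dx .$$
   Context: $\mathcal{S}_1$ denotes the set of functions $f:\mathbb{R}\to\mathbb{C}$ that are $1$-periodic, have discontinuities at most at the integers, and are absolutely continuous on $(0,1)$; for such $f$ the one-sided limits $f(0^+)$, $f(1^-)$ exist, and $f'$ denotes its derivative (defined almost everywhere). For $\mathbf{f}$ and $\boldsymbol{\nu}$ as in the claim, the Dedekind sums are $S_{\mathbf{f}}(\boldsymbol{\nu}\mid\nu_k)=\sum_{i=1}^{\nu_k-1}\prod_{j\neq k} f_j\!\left(\frac{i\nu_j}{\nu_k}\right)$ for $k=0,\ldots,r$. Set $\Delta f_j := f_j(1^-)-f_j(0^+)$, $\Delta\mathbf{f}:=\prod_{j=0}^r f_j(1^-)-\prod_{j=0}^r f_j(0^+)$, and define the reciprocity $\mathcal{R}_{\mathbf{f}}(\boldsymbol{\nu}):=\sum_{k=0}^r S_{\mathbf{f}}(\boldsymbol{\nu}\mid\nu_k)\,\Delta f_k$. *)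

(* Defs.v *)
From HB Require Import structures.
From mathcomp Require Import all_boot all_order all_algebra.
From mathcomp Require Import complex.
From mathcomp Require Import all_classical all_reals all_analysis.

Set Implicit Arguments.
Unset Strict Implicit.
Unset Printing Implicit Defensive.

Import Order.TTheory GRing.Theory Num.Theory.
Import numFieldNormedType.Exports.

Local Open Scope classical_set_scope.
Local Open Scope ring_scope.
Local Open Scope complex_scope.

(* The epsilon-delta definition over finite families of non-overlapping
   intervals with endpoints in I.  The bound is uniform on I: for I = ]0, 1[ this
   is stronger than absolute continuity on every compact subinterval, and
   it is what makes the one-sided limits at 0 and 1 exist. *)
Definition absolutely_continuous_on (R : realType) (I : set R)
    (f : R -> R[i]) : Prop :=
  forall e : R, 0 < e -> exists2 d : R, 0 < d &
    forall (n : nat) (a b : 'I_n -> R),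
      (forall i, [/\ I (a i), I (b i) & a i <= b i]) ->
      trivIset setT (fun i => `]a i, b i[%classic) ->
      \sum_(i < n) (b i - a i) < d ->
      \sum_(i < n) ComplexField.Normc.normc (f (b i) - f (a i)) < e.

(* R[i] carries its topology through the alias R[i]^o. *)
Definition S1 (R : realType) (f : R -> R[i]) : Prop :=
  [/\ periodic f 1,
      forall x : R, x \isn't a Num.int -> {for x, continuous (f : R -> R[i]^o)}
    & absolutely_continuous_on `]0, 1[ f].

Definition right_lim0 (R : realType) (f : R -> R[i]) : R[i] :=
  lim ((f x : R[i]^o) @[x --> (0 : R)^'+]).

Definition left_lim1 (R : realType) (f : R -> R[i]) : R[i] :=
  lim ((f x : R[i]^o) @[x --> (1 : R)^'-]).

(* derive1 is not available for R[i]-valued functions of a real variable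
   (R[i] is not equipped with a normed R-module structure); this is the same
   limit of difference quotients. *)
Definition cderive1 (R : realType) (f : R -> R[i]) (x : R) : R[i] :=
  lim (((h^-1)%:C * (f (h + x) - f x) : R[i]^o) @[h --> (0 : R)^']).

Definition cintegral (R : realType) (D : set R) (f : R -> R[i]) : R[i] :=
  (\int[lebesgue_measure]_(x in D) complex.Re (f x))%R +i*
  (\int[lebesgue_measure]_(x in D) complex.Im (f x))%R.

Definition dedekind_sum (R : realType) (r : nat) (f : 'I_r.+1 -> R -> R[i])
    (nu : 'I_r.+1 -> nat) (k : 'I_r.+1) : R[i] :=
  \sum_(1 <= i < nu k)
    \prod_(j < r.+1 | j != k) f j ((i * nu j)%:R / (nu k)%:R).

Definition jump (R : realType) (f : R -> R[i]) : R[i] := left_lim1 f - right_lim0 f.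

Definition jump_prod (R : realType) (r : nat) (f : 'I_r.+1 -> R -> R[i]) : R[i] :=
  \prod_(j < r.+1) left_lim1 (f j) - \prod_(j < r.+1) right_lim0 (f j).

Definition reciprocity (R : realType) (r : nat) (f : 'I_r.+1 -> R -> R[i])
    (nu : 'I_r.+1 -> nat) : R[i] :=
  \sum_(k < r.+1) dedekind_sum f nu k * jump (f k).

(* Main.v *)
Require Import Defs.
From HB Require Import structures.
From mathcomp Require Import all_boot all_order all_algebra.
From mathcomp Require Import complex.
From mathcomp Require Import all_classical all_reals all_analysis.
From mathcomp Require Import measurable_realfun.
From mathcomp Require Import ring lra.
Import Order.TTheory GRing.Theory Num.Theory.
Import numFieldNormedType.Exports.
Set Implicit Arguments.
Unset Strict Implicit.
Unset Printing Implicit Defensive.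
Local Open Scope classical_set_scope.
Local Open Scope ring_scope.
Local Open Scope complex_scope.

(** The function [H x = \prod_j f_j (nu_j x)] is absolutely continuous between
    consecutive points of the grid [m / N], [N = \prod_j nu_j], so integrating
    [H'] over [[0, 1]] gives [H(1^-) - H(0^+)] minus the jumps of [H] at the
    interior grid points.  By coprimality at most one factor jumps at such a
    point, the [k]-th one exactly at the [i / nu_k], and collecting these jumps
    yields the Dedekind sums.

    The fundamental theorem of calculus for an absolutely continuous [f] is
    obtained by writing [f] as the difference of its total variation [V] and
    [V - f]: both are nondecreasing and absolutely continuous, hence their
    Lebesgue-Stieltjes measures have Radon-Nikodym densities with respect to
    the Lebesgue measure, and Lebesgue's differentiation theorem identifies the
    densities with the derivatives almost everywhere. *)

(** * Absolutely continuous real functions *)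

Lemma cvg_sumr {T : Type} {F : set_system T} {FF : Filter F} (K : numFieldType)
    (I : Type) (r : seq I) (P : pred I) (f : I -> T -> K) (l : I -> K) :
  (forall i, P i -> f i @ F --> l i) ->
  \sum_(i <- r | P i) f i x @[x --> F] --> \sum_(i <- r | P i) l i.
Proof.
move=> fl; elim: r => [|i r IH].
  rewrite big_nil; under eq_fun do rewrite big_nil; exact: cvg_cst.
rewrite big_cons; under eq_fun do rewrite big_cons.
by case: ifPn => // Pi; apply: cvgD => //; exact: fl.
Qed.

Lemma cvg_prodr {T : Type} {F : set_system T} {FF : Filter F} (K : numFieldType)
    (I : Type) (r : seq I) (P : pred I) (f : I -> T -> K) (l : I -> K) :
  (forall i, P i -> f i @ F --> l i) ->
  \prod_(i <- r | P i) f i x @[x --> F] --> \prod_(i <- r | P i) l i.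
Proof.
move=> fl; elim: r => [|i r IH].
  rewrite big_nil; under eq_fun do rewrite big_nil; exact: cvg_cst.
rewrite big_cons; under eq_fun do rewrite big_cons.
by case: ifPn => // Pi; apply: cvgM => //; exact: fl.
Qed.

Section real_absolute_continuity.
Context {R : realType}.
Implicit Types (I J : set R) (f g h : R -> R) (a b x y e d : R).

(** The real-valued counterpart of [absolutely_continuous_on]. Families are indexed by an arbitrary
    finite type, so that a single interval or the cells of several subdivisions fit without
    renumbering. *)
Definition real_ac I f := forall e, 0 < e -> exists2 d, 0 < d &
  forall (T : finType) (x y : T -> R),
    (forall i, [/\ I (x i), I (y i) & x i <= y i]) ->
    trivIset setT (fun i => `]x i, y i[%classic) ->
    \sum_i (y i - x i) < d -> \sum_i `|f (y i) - f (x i)| < e.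

Lemma real_ac_dom C I f g h : 0 <= C -> real_ac I f -> real_ac I g ->
  (forall x y, I x -> I y ->
    `|h y - h x| <= C * (`|f y - f x| + `|g y - g x|)) ->
  real_ac I h.
Proof.
move=> C0 acf acg hfg e e0.
(* [C + 1] rather than [C] keeps the denominator positive when [C = 0]. *)
have e'0 : 0 < e / (2 * (C + 1)) by rewrite divr_gt0// mulr_gt0// ltr_wpDl.
have [d1 d10 H1] := acf _ e'0; have [d2 d20 H2] := acg _ e'0.
exists (Num.min d1 d2); first by rewrite lt_min d10.
move=> T x y Ixy dxy; rewrite lt_min => /andP[sd1 sd2].
have {}H1 := H1 _ _ _ Ixy dxy sd1; have {}H2 := H2 _ _ _ Ixy dxy sd2.
apply: (@le_lt_trans _ _ (C * (\sum_i `|f (y i) - f (x i)| +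
                          \sum_i `|g (y i) - g (x i)|))).
  rewrite -big_split/= mulr_sumr ler_sum// => i _.
  by have [? ? _] := Ixy i; exact: hfg.
rewrite (@le_lt_trans _ _ (C * (e / (2 * (C + 1)) + e / (2 * (C + 1)))))//.
  by rewrite ler_wpM2l// ltW// ltrD.
have -> : C * (e / (2 * (C + 1)) + e / (2 * (C + 1))) = e * (C / (C + 1)).
  by field; rewrite gt_eqF// ltr_wpDl.
by rewrite gtr_pMr// ltr_pdivrMr ?ltr_wpDl// mul1r ltrDl.
Qed.

Lemma real_ac_eq I f g : {in I, f =1 g} -> real_ac I f -> real_ac I g.
Proof.
move=> fg acf e /acf[d d0 H]; exists d => // T x y Ixy dxy xyd.
rewrite (eq_bigr (fun i => `|f (y i) - f (x i)|)); first exact: H.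
by move=> i _; have [? ? _] := Ixy i; rewrite !fg ?inE.
Qed.

Lemma real_acB I f g : real_ac I f -> real_ac I g -> real_ac I (f \- g).
Proof.
move=> acf acg; apply: (real_ac_dom ler01 acf acg) => x y _ _ /=.
rewrite mul1r; have -> : f y - g y - (f x - g x) = (f y - f x) - (g y - g x).
  by ring.
exact: ler_normB.
Qed.

Lemma real_acD I f g : real_ac I f -> real_ac I g -> real_ac I (f \+ g).
Proof.
move=> acf acg; apply: (real_ac_dom ler01 acf acg) => x y _ _ /=.
by rewrite mul1r opprD addrACA ler_normD.
Qed.

Lemma real_acM M I f g : (forall x, I x -> `|f x| <= M) ->
  (forall x, I x -> `|g x| <= M) ->
  real_ac I f -> real_ac I g -> real_ac I (f \* g).
Proof.
move=> fM gM acf acg; apply: (@real_ac_dom `|M| _ f g) => // x y Ix Iy /=.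
have -> : f y * g y - f x * g x = (f y - f x) * g y + f x * (g y - g x) by ring.
rewrite (le_trans (ler_normD _ _))// !normrM mulrDr lerD//.
  by rewrite mulrC ler_wpM2r// (le_trans (gM _ Iy))// ler_norm.
by rewrite ler_wpM2r// (le_trans (fM _ Ix))// ler_norm.
Qed.

Lemma real_ac_cst I (c : R) : real_ac I (cst c).
Proof.
move=> e e0; exists 1 => // T x y _ _ _.
by rewrite big1// => i _; rewrite subrr normr0.
Qed.

Lemma real_ac_affine (k c : R) I J f : 0 < k ->
  (forall x, J x -> I (k * x + c)) ->
  real_ac I f -> real_ac J (fun x => f (k * x + c)).
Proof.
move=> k0 JI acf e /acf[d d0 H]; exists (d / k); first exact: divr_gt0.
move=> T x y Jxy dxy sxy.
apply: (H _ (fun i => k * x i + c) (fun i => k * y i + c)).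
- move=> i; have [Jx Jy xy] := Jxy i; split; [exact: JI|exact: JI|].
  by rewrite lerD2r ler_pM2l.
- move=> i j _ _ [z [/=]]; rewrite !in_itv/= => zi zj.
  apply: dxy => //; exists ((z - c) / k); split; rewrite /= in_itv/=.
    by rewrite ltr_pdivrMr// ltr_pdivlMr// ltrBlDr ltrBrDr ![_ * k]mulrC.
  by rewrite ltr_pdivrMr// ltr_pdivlMr// ltrBlDr ltrBrDr ![_ * k]mulrC.
- under eq_bigr do rewrite opprD addrACA subrr addr0 -mulrBr.
  by rewrite -mulr_sumr mulrC -ltr_pdivlMr.
Qed.

Lemma real_ac_unif_cont I f : real_ac I f -> forall e, 0 < e ->
  exists2 d, 0 < d & forall x y, I x -> I y -> `|x - y| < d -> `|f x - f y| < e.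
Proof.
move=> acf e /acf[d d0 H]; exists d => //.
suff key x y : I x -> I y -> x <= y -> `|x - y| < d -> `|f x - f y| < e.
  move=> x y Ix Iy xyd; have [xy|/ltW yx] := leP x y; first exact: key.
  by rewrite distrC key// distrC.
move=> Ix Iy xy; rewrite distrC ger0_norm ?subr_ge0// => xyd.
have sum1 (c : R) : \sum_(i : unit) c = c by rewrite big_const card_unit/= addr0.
have := H unit (fun=> x) (fun=> y) (fun=> And3 Ix Iy xy).
by rewrite !sum1 distrC; apply => // -[] [].
Qed.

(** For [a <= b], [Num.max a (Num.min b x)] is the projection of [x] onto [[a, b]]. It serves twice
    below: to push endpoints into a smaller interval, and to extend a function constantly beyond
    [[a, b]]. *)
Lemma clamp_homo a b x y : x <= y ->
  Num.max a (Num.min b x) <= Num.max a (Num.min b y).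
Proof.
by move=> xy; rewrite ge_max le_max lexx/= le_max le_min !ge_min lexx xy !orbT.
Qed.

Lemma clamp_dist a b x y :
  `|Num.max a (Num.min b x) - Num.max a (Num.min b y)| <= `|x - y|.
Proof.
wlog xy : x y / x <= y.
  move=> W; have [xy|/ltW yx] := leP x y; first exact: W.
  by rewrite distrC (distrC x) W.
rewrite ler_distlC (ler0_norm (_ : x - y <= 0)) ?subr_le0// /Num.max /Num.min.
case: (ltP b x) => bx; case: (ltP b y) => yb; do ?case: ifPn;
  rewrite -?leNgt => *; apply/andP; split; lra.
Qed.

Let cvg_right a (b : R) f : a < b -> real_ac `]a, b[ f ->
  cvg (f x @[x --> a^'+]).
Proof.
move=> ab /real_ac_unif_cont uf; apply: cauchy_cvg; apply: cauchy_exP => e e0.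
have [d d0 H] := uf _ e0.
(* The centre [a + m / 2] and every [x] between [a] and it lie in []a, b[] at distance less than
   [d], which gives the Cauchy criterion. *)
pose m := Num.min d (b - a); have m0 : 0 < m by rewrite lt_min d0 subr_gt0.
exists (f (a + m / 2)).
suff: \forall x \near a^'+, ball (f (a + m / 2)) e (f x) by [].
near=> x.
have ax : a < x by near: x; exact: nbhs_right_gt.
have xm : x < a + m / 2.
  by near: x; apply: nbhs_right_lt; rewrite ltrDl divr_gt0.
have mb : m <= b - a by rewrite ge_min lexx orbT.
have md : m <= d by rewrite ge_min lexx.
apply: H; rewrite /= ?in_itv/=.
- by apply/andP; split; lra.
- by rewrite ax/=; lra.
- by rewrite ger0_norm; lra.
Unshelve. all: by end_near. Qed.

Let cvg_left (a : R) b f : a < b -> real_ac `]a, b[ f ->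
  cvg (f x @[x --> b^'-]).
Proof.
move=> ab /real_ac_unif_cont uf; apply: cauchy_cvg; apply: cauchy_exP => e e0.
have [d d0 H] := uf _ e0.
pose m := Num.min d (b - a); have m0 : 0 < m by rewrite lt_min d0 subr_gt0.
exists (f (b - m / 2)).
suff: \forall x \near b^'-, ball (f (b - m / 2)) e (f x) by [].
near=> x.
have ax : x < b by near: x; exact: nbhs_left_lt.
have xm : b - m / 2 < x.
  by near: x; apply: nbhs_left_gt; rewrite ltrBlDr ltrDl divr_gt0.
have mb : m <= b - a by rewrite ge_min lexx orbT.
have md : m <= d by rewrite ge_min lexx.
apply: H; rewrite /= ?in_itv/=.
- by apply/andP; split; lra.
- by rewrite ax andbT; lra.
- by rewrite ler0_norm; lra.
Unshelve. all: by end_near. Qed.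

(* The endpoints of the intervals are moved into [a + t, b - t] and t tends to 0. *)
Lemma real_ac_closure a b f : a < b -> real_ac `]a, b[ f ->
  exists g, [/\ real_ac `[a, b] g, {in `]a, b[, g =1 f},
    f x @[x --> a^'+] --> g a & f x @[x --> b^'-] --> g b].
Proof.
move=> ab acf.
pose la := lim (f x @[x --> a^'+]); pose lb := lim (f x @[x --> b^'-]).
have fla : f x @[x --> a^'+] --> la by exact: cvg_right acf.
have flb : f x @[x --> b^'-] --> lb by exact: cvg_left acf.
pose g x := if x <= a then la else if b <= x then lb else f x.
pose cl (t x : R) := Num.max (a + t) (Num.min (b - t) x).
have gcl x : x \in `[a, b] -> f (cl t x) @[t --> 0^'+] --> g x.
  rewrite in_itv/= => /andP[]; rewrite /g le_eqVlt => /predU1P[<- _|ax].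
    rewrite lexx; apply/cvgrPdist_lt => e e0.
    move/cvgrPdist_lt: fla => /(_ _ e0)[d /= d0 H]; near=> t.
    have t0 : 0 < t by near: t; exact: nbhs_right_gt.
    have td : t < d by near: t; exact: nbhs_right_lt.
    have tba : t < (b - a) / 2.
      by near: t; apply: nbhs_right_lt; rewrite divr_gt0// subr_gt0.
    have -> : cl t a = a + t.
      by rewrite /cl min_r ?max_l ?lerDl ?ltW//; lra.
    by apply: H => /=; rewrite ?ltrDl// opprD addNKr normrN gtr0_norm.
  rewrite le_eqVlt => /predU1P[->|xb].
    rewrite leNgt ab/= lexx; apply/cvgrPdist_lt => e e0.
    move/cvgrPdist_lt: flb => /(_ _ e0)[d /= d0 H]; near=> t.
    have t0 : 0 < t by near: t; exact: nbhs_right_gt.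
    have td : t < d by near: t; exact: nbhs_right_lt.
    have tba : t < (b - a) / 2.
      by near: t; apply: nbhs_right_lt; rewrite divr_gt0// subr_gt0.
    have -> : cl t b = b - t.
      by rewrite /cl min_l ?max_r//; lra.
    apply: H => /=; first by rewrite opprB addrC subrK gtr0_norm.
    by rewrite ltrBlDr ltrDl.
  rewrite leNgt ax/= leNgt xb/=.
  apply: (@cvg_trans _ (f x @[t --> 0^'+])); last exact: cvg_cst.
  apply: near_eq_cvg; near=> t.
  have t1 : t < x - a by near: t; apply: nbhs_right_lt; rewrite subr_gt0.
  have t2 : t < b - x by near: t; apply: nbhs_right_lt; rewrite subr_gt0.
  by rewrite /cl min_r ?max_r//; lra.
have ga : g a = la by rewrite /g lexx.
have gb : g b = lb by rewrite /g leNgt ab/= lexx.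
exists g; split; rewrite ?ga ?gb//; last first.
  by move=> x; rewrite in_itv/= /g => /andP[ax xb]; rewrite leNgt ax leNgt xb.
(* The limit in [t] preserves only weak inequalities; aiming at [e / 2] makes the final one
   strict. *)
move=> e e0; have e20 : 0 < e / 2 by rewrite divr_gt0.
have [d d0 H] := acf _ e20.
exists d => // T x y Ixy dxy sd.
apply: (@le_lt_trans _ _ (e / 2)); last by lra.
have : \sum_i `|f (cl t (y i)) - f (cl t (x i))| @[t --> 0^'+] -->
    \sum_i `|g (y i) - g (x i)|.
  apply: cvg_sumr => i _; have [? ? _] := Ixy i.
  by apply: cvg_norm; apply: cvgB; exact: gcl.
move=> gfT; rewrite -(cvg_lim _ gfT)//; apply: limr_le; first exact: cvgP gfT.
near=> t; apply/ltW.
have t0 : 0 < t by near: t; exact: nbhs_right_gt.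
have tba : t < (b - a) / 2.
  by near: t; apply: nbhs_right_lt; rewrite divr_gt0// subr_gt0.
have clP z : `]a, b[%classic (cl t z).
  rewrite /= in_itv/= /cl lt_max gt_max gt_min.
  by apply/andP; split; [apply/orP|apply/andP; split; last apply/orP];
    [left|idtac|left]; lra.
have cl_le u v : u <= v -> cl t u <= cl t v /\ cl t v - cl t u <= v - u.
  move=> uv; split; first exact: clamp_homo.
  rewrite (le_trans (ler_norm _))// (le_trans (clamp_dist _ _ _ _))//.
  by rewrite ger0_norm ?subr_ge0.
apply: H.
- by move=> i; have [? ? /cl_le[? _]] := Ixy i; split.
- move=> i j _ _ [z [/=]]; rewrite !in_itv/= => zi zj.
  apply: dxy => //; exists z.
  (* A point strictly between two projected values lies strictly between the original ones, so
     disjointness is inherited. *)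
  suff cl_in u v : cl t u < z < cl t v -> u < z < v.
    by split; rewrite /= in_itv/=; exact: cl_in.
  rewrite /cl gt_max lt_max gt_min lt_min; move=> /andP[/andP[h1 h2] h3].
  have zb : z < b - t.
    by move: h3 => /orP[|/andP[]//]; rewrite ltNge (ltW h1).
  move: h2; rewrite (ltNge _ z) (ltW zb)/= => ->/=.
  by move: h3; rewrite (ltNge z) (ltW h1)/= => /andP[].
- apply: le_lt_trans sd; apply: ler_sum => i _.
  by have [_ _ /cl_le[]] := Ixy i.
Unshelve. all: by end_near. Qed.

Lemma itv_partition_nth_homo a b (s : seq R) k l : itv_partition a b s ->
  (k <= l <= size s)%N -> nth b (a :: s) k <= nth b (a :: s) l.
Proof.
move=> [ps _] /andP[]; rewrite leq_eqVlt => /predU1P[-> //|kl ls].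
apply/ltW/(sorted_ltn_nth lt_trans b (s := a :: s)) => //; rewrite inE/= ltnS//.
exact/ltnW/(leq_trans kl).
Qed.

(** The cells of all the subdivisions [s i] form one finite disjoint family, indexed by the sigma
    type [S], whose total length telescopes to the same sum. Hence the [d] that controls increments
    controls variations too. *)
Lemma real_ac_variation I f : real_ac I f -> is_interval I ->
  forall e, 0 < e -> exists2 d, 0 < d &
  forall (T : finType) (x y : T -> R) (s : T -> seq R),
    (forall i, [/\ I (x i), I (y i) & x i <= y i]) ->
    trivIset setT (fun i => `]x i, y i[%classic) ->
    \sum_i (y i - x i) < d -> (forall i, itv_partition (x i) (y i) (s i)) ->
    \sum_i variation (x i) (y i) f (s i) < e.
Proof.
move=> acf Iitv e /acf[d d0 H]; exists d => // T x y s Ixy dxy sd ps.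
pose p i k := nth (y i) (x i :: s i) k.
pose S := {i : T & 'I_(size (s i))}.
pose u (t : S) := p (tag t) (tagged t); pose v (t : S) := p (tag t) (tagged t).+1.
have p_homo i k l : (k <= l <= size (s i))%N -> p i k <= p i l.
  exact: itv_partition_nth_homo.
have xp i k : (k <= size (s i))%N -> x i <= p i k by move=> ks; exact: (p_homo _ 0%N).
have py i k : (k <= size (s i))%N -> p i k <= y i.
  by move=> ks; rewrite /p itv_partition_nth_le.
have Ip i k : (k <= size (s i))%N -> I (p i k).
  by move=> ks; have [Ix Iy _] := Ixy i; apply: (Iitv _ _ Ix Iy); rewrite xp//= py.
rewrite (_ : \sum_i _ = \sum_(t : S) `|f (v t) - f (u t)|); last first.
  rewrite (eq_bigr (fun i => \sum_(j < size (s i)) `|f (p i j.+1) - f (p i j)|)).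
    by rewrite sig_big_dep.
  by move=> i _; rewrite /variation big_mkord.
apply: H.
- move=> [i j]; rewrite /u /v/=; split; [|exact: Ip|].
    exact/Ip/ltnW.
  by apply: p_homo; rewrite leqnSn/=.
- move=> [i j] [i' j'] _ _ [z []]; rewrite /= /u /v !in_itv/=.
  move=> /andP[z1 z2] /andP[z3 z4].
  have ii' : i = i'.
    apply: dxy => //; exists z; split; rewrite /= in_itv/=.
      by rewrite (le_lt_trans _ z1) ?(lt_le_trans z2)// ?xp ?py// ltnW.
    by rewrite (le_lt_trans _ z3) ?(lt_le_trans z4)// ?xp ?py// ltnW.
  move: ii' j' z3 z4 => <- j' z3 z4; congr existT; apply/val_inj/eqP.
  rewrite eqn_leq; apply/andP; split; rewrite leqNgt; apply/negP => jj'.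
    have := lt_trans z1 z4; rewrite ltNge => /negP; apply; apply: p_homo.
    by rewrite jj' ltnW.
  have := lt_trans z3 z2; rewrite ltNge => /negP; apply; apply: p_homo.
  by rewrite jj' ltnW.
- apply: le_lt_trans sd; rewrite le_eqVlt; apply/orP; left; apply/eqP.
  rewrite (eq_bigr (fun i => \sum_(j < size (s i)) (p i j.+1 - p i j))).
    by rewrite sig_big_dep.
  move=> i _; rewrite -(big_mkord xpredT (fun j => p i j.+1 - p i j)).
  by rewrite telescope_sumr// /p (itv_partition_nth_size _ (ps i)).
Qed.

(** With the [d] associated with [e = 1], a piece shorter than [d] has variation at most 1, and
    finitely many steps of length [d / 2] lead from [x] to [y]. *)
Lemma real_ac_total_variation_lty I f x y : real_ac I f -> is_interval I ->
  I x -> I y -> x <= y -> (total_variation x y f < +oo)%E.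
Proof.
move=> acf Iitv Ix Iy xy; have [d d0 H] := real_ac_variation acf Iitv ltr01.
have short u v : I u -> I v -> u <= v -> v - u < d ->
    (total_variation u v f < +oo)%E.
  move=> Iu Iv uv vud; apply: (@le_lt_trans _ _ 1%E); last by rewrite ltry.
  apply: ge_ereal_sup => _ [_ [s ps <-] <-]; rewrite lee_fin ltW//.
  have sum1 (c : R) : \sum_(i : unit) c = c by rewrite big_const card_unit/= addr0.
  have := H unit (fun=> u) (fun=> v) (fun=> s).
  rewrite !sum1; by apply => //; move=> [] [].
have step n z : I z -> x <= z -> z - x < n%:R * (d / 2) ->
    (total_variation x z f < +oo)%E.
  elim: n z => [z _ xz|n IH z Iz xz zn].
    by rewrite mul0r subr_lt0 ltNge xz.
  have [zd|dz] := ltP (z - x) d; first exact: short.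
  pose w := z - d / 2.
  have xw : x <= w by rewrite /w; lra.
  have wz : w <= z by rewrite /w; lra.
  have Iw : I w by apply: (Iitv _ _ Ix Iz); rewrite xw.
  rewrite (total_variationD _ xw wz) lte_add_pinfty//.
    by apply: IH => //; move: zn; rewrite /w -natr1; lra.
  by apply: short => //; rewrite /w; lra.
have d20 : 0 < d / 2 by rewrite divr_gt0.
apply: (step (Num.bound ((y - x) / (d / 2)))) => //.
rewrite -ltr_pdivrMr//; apply: le_lt_trans (archi_boundP _); first by [].
by rewrite divr_ge0 ?subr_ge0// ltW.
Qed.

Lemma real_ac_total_variation a b f : a <= b -> real_ac `[a, b] f ->
  real_ac `[a, b] (fun x => fine (total_variation a x f)).
Proof.
move=> ab acf e e0; have e20 : 0 < e / 2 by rewrite divr_gt0.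
have Iitv := @interval_is_interval R `[a, b].
have [d d0 H] := real_ac_variation acf Iitv e20.
exists d => // T x y Ixy dxy sd.
have fin u v : `[a, b]%classic u -> `[a, b]%classic v -> u <= v ->
    total_variation u v f \is a fin_num.
  move=> Iu Iv uv; rewrite ge0_fin_numE ?total_variation_ge0//.
  exact: (real_ac_total_variation_lty acf).
have aI : `[a, b]%classic a by rewrite /= in_itv/= lexx.
have TVE i : `|fine (total_variation a (y i) f) -
               fine (total_variation a (x i) f)| =
    fine (total_variation (x i) (y i) f).
  have [Ix Iy xy] := Ixy i.
  have ax : a <= x i by move: Ix; rewrite /= in_itv/= => /andP[].
  rewrite (total_variationD _ ax xy) fineD; [|exact: fin..].
  by rewrite addrAC subrr add0r ger0_norm// fine_ge0// total_variation_ge0.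
under eq_bigr do rewrite TVE.
(* [c] is the error allowed for each near-optimal subdivision: together they cost at most [e / 4],
   and the successor avoids a division by 0 when [T] is empty. *)
pose c := e / 4 / (#|T|.+1)%:R.
have c0 : 0 < c by rewrite !divr_gt0.
have [s Hs] : {s : T -> seq R & forall i, itv_partition (x i) (y i) (s i) /\
    fine (total_variation (x i) (y i) f) <= variation (x i) (y i) f (s i) + c}.
  apply: (@choice _ _ (fun i s => itv_partition (x i) (y i) s /\
    fine (total_variation (x i) (y i) f) <= variation (x i) (y i) f s + c)) => i.
  have [Ix Iy xy] := Ixy i; have tvfin := fin _ _ Ix Iy xy.
  have [_ [_ [s ps <-] <-] Hs] := ub_ereal_sup_adherent c0 tvfin.
  exists s; split => //; rewrite -lerBlDr -lee_fin EFinB fineK//; exact: ltW.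
have {}H := H T x y s Ixy dxy sd (fun i => (Hs i).1).
apply: (@le_lt_trans _ _ (\sum_i (variation (x i) (y i) f (s i) + c))).
  by apply: ler_sum => i _; exact: (Hs i).2.
rewrite big_split/= sumr_const -mulr_natr.
suff : c * #|T|%:R <= e / 4 by lra.
rewrite /c -mulrA ler_piMr ?divr_ge0 ?ltW// ?ltW//.
by rewrite mulrC ltr_pdivrMr// mul1r ltr_nat.
Qed.

End real_absolute_continuity.

(** * The fundamental theorem of calculus *)

Section absolutely_continuous_primitive.
Context {R : realType}.
Implicit Types (f g h : R -> R) (a b x y e d : R).
Local Notation mu := (@lebesgue_measure R).

Lemma lebesgue_stieltjes_measure_itvoc (G : cumulative R R) x y : x <= y ->
  lebesgue_stieltjes_measure G `]x, y] = (G y - G x)%:E.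
Proof.
move=> xy; rewrite /lebesgue_stieltjes_measure /measure_extension.
by rewrite measurable_mu_extE/= ?wlength_itv_bnd//; exact: is_ocitv.
Qed.

(** Absolute continuity controls only intervals with endpoints in [[a, b]], while an interval
    component [J] of an open set may overhang it. The infimum and supremum of the trace of [J] on
    []a, b]] provide suitable endpoints. *)
Lemma open_interval_itvoc_cover (J : set R) a b : a <= b -> open J ->
  is_interval J -> exists x y, [/\ a <= x <= y, y <= b,
    J `&` `]a, b] `<=` `]x, y] & `]x, y[ `<=` J].
Proof.
move=> ab oJ iJ; set K := J `&` `]a, b].
have [K0|/set0P[k Kk]] := eqVneq K set0.
  exists a, a; rewrite lexx; split => //; first by rewrite K0.
  by move=> z /=; rewrite in_itv/= => /andP[az /(lt_trans az)]; rewrite ltxx.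
have Kab z : K z -> a < z <= b by move=> [_]; rewrite /= in_itv.
have Kinf : has_inf K.
  by split; [exists k|exists a => z /Kab/andP[/ltW]].
have Ksup : has_sup K.
  by split; [exists k|exists b => z /Kab/andP[]].
have infK z : K z -> inf K <= z by move=> Kz; exact: (ge_inf Kinf.2).
have supK z : K z -> z <= sup K by move=> Kz; exact: (ub_le_sup Ksup.2).
exists (inf K), (sup K); split.
- rewrite lb_le_inf//=; [|by exists k|by move=> z /Kab/andP[/ltW]].
  by rewrite (le_trans (infK _ Kk))// supK.
- by apply: ge_sup; [exists k|move=> z /Kab/andP[]].
(* The infimum is not attained: [J] is open, so points slightly to the left of [z], still above [a],
   would belong to [K]. *)
- move=> z Kz; rewrite /= in_itv/= supK// andbT lt_neqAle infK// andbT.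
  apply/eqP => infz; have /andP[az _] := Kab _ Kz.
  have : \forall t \near z^'-, J t.
    by apply: cvg_within; apply: open_nbhs_nbhs; split => //; exact: Kz.1.
  move=> Jt; near z^'- => t.
  have tz : t < z by near: t; exact: nbhs_left_lt.
  have at' : a < t by near: t; exact: nbhs_left_gt.
  have : inf K <= t.
    apply: infK; split; first by near: t.
    rewrite /= in_itv/= at'/= (le_trans (ltW tz))//.
    by have /andP[] := Kab _ Kz.
  by rewrite infz leNgt tz.
- move=> z /=; rewrite in_itv/= => /andP[iz zs].
  have [u Ku uz] := inf_adherent (eps := z - inf K) ltac:(by rewrite subr_gt0) Kinf.
  have [v Kv zv] := sup_adherent (eps := sup K - z) ltac:(by rewrite subr_gt0) Ksup.
  apply: (iJ u v Ku.1 Kv.1); rewrite subrKC in uz; rewrite opprB subrKC in zv.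
  by rewrite !ltW.
Unshelve. all: by end_near. Qed.

(** By outer regularity a null set [A] lies in an open set of measure below [d]. The disjoint
    interval components of this set, cut down to [[a, b]], have total length below [d], so the
    Stieltjes measure of [A] inside []a, b]] is at most [e]. *)
Lemma lebesgue_stieltjes_dominates (G : cumulative R R) a b
    (D : set (measurableTypeR R)) : a <= b ->
  real_ac `[a, b] G -> D = `]a, b]%classic -> forall mD moo,
  @mfrestr _ _ _ D (lebesgue_stieltjes_measure G) mD moo `<< mu.
Proof.
move=> ab acG DE mD moo; apply/null_content_dominatesP => A mA A0.
rewrite /mfrestr /mrestr {}DE.
apply/eqP; rewrite eq_le measure_ge0 andbT; apply/lee_addgt0Pr => e e0; rewrite add0e.
have [d d0 H] := acG _ e0.
have Aoo : (mu A < +oo)%E by rewrite A0 ltry.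
have [U [oU AU UA]] := lebesgue_regularity_outer mA Aoo d0.
have mU : measurable U by exact: open_measurable.
have Ud : (mu U < d%:E)%E.
  rewrite -(setDUK AU) measureU//; [|exact: measurableD|by rewrite setDIK].
  by rewrite A0 add0r.
have [J [oiJ dJ UJ]] := OpenSetDisjointItvs.open_disjoint_itv oU.
have /choice[xy Hxy] : forall q, exists xy : R * R, [/\ a <= xy.1 <= xy.2,
    xy.2 <= b, J q `&` `]a, b] `<=` `]xy.1, xy.2] & `]xy.1, xy.2[ `<=` J q].
  move=> q; have [oq iq] := oiJ q.
  by have [x [y H']] := open_interval_itvoc_cover ab oq iq; exists (x, y).
pose x q := (xy q).1; pose y q := (xy q).2.
have xy_le q : x q <= y q by have [/andP[]] := Hxy q.
apply: (@le_trans _ _ (\sum_(q <oo)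
    lebesgue_stieltjes_measure G `]x q, y q]%classic)%E).
  apply: measure_sigma_subadditive.
  - by move=> q; exact: measurable_itv.
  - by apply: measurableI => //; exact: measurable_itv.
  - move=> z [/AU + zab]; rewrite UJ => -[q _ Jqz]; exists q => //.
    by have [_ _ + _] := Hxy q; apply.
(* Absolute continuity concerns finite families, so each partial sum of the series is bounded. *)
apply: lime_le; first exact: is_cvg_nneseries.
apply: nearW => n; rewrite big_mkord.
under eq_bigr do rewrite lebesgue_stieltjes_measure_itvoc//.
rewrite sumEFin lee_fin.
apply: (@le_trans _ _ (\sum_(q < n) `|G (y q) - G (x q)|)).
  by apply: ler_sum => q _; exact: ler_norm.
apply/ltW/H.
- move=> q; have [/andP[aq xyq] yb _ _] := Hxy q.
  rewrite /= !in_itv/= -/(x q) -/(y q) xyq aq yb (le_trans xyq yb).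
  by rewrite (le_trans aq xyq).
- move=> i j _ _ [z [/= zi zj]]; apply/val_inj/(dJ _ _ I I).
  exists z; split; first by have [_ _ _] := Hxy i; apply.
  by have [_ _ _] := Hxy j; apply.
- rewrite -lte_fin -sumEFin (le_lt_trans _ Ud)//.
  rewrite (eq_bigr (fun q : 'I_n => mu `]x q, y q[%classic)); last first.
    move=> q _; rewrite lebesgue_measure_itv/= lte_fin.
    have := xy_le q; rewrite le_eqVlt => /predU1P[->|->]; last by rewrite EFinB.
    by rewrite ltxx subrr.
  rewrite -measure_bigsetU_ord.
  + rewrite le_measure ?inE//.
      by apply: bigsetU_measurable => q _; exact: measurable_itv.
    rewrite UJ -(bigcup_mkord n (fun q => `]x q, y q[%classic)) => z [q _ zq].
    by exists q => //; have [_ _ _] := Hxy q; apply.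
  + by move=> q; exact: measurable_itv.
  + move=> i j _ _ [z [zi zj]]; apply/val_inj/(dJ _ _ I I).
    exists z; split; first by have [_ _ _] := Hxy i; apply.
    by have [_ _ _] := Hxy j; apply.
Qed.

Lemma real_ac_clamp_continuous a b f : a <= b -> real_ac `[a, b] f ->
  continuous (fun x => f (Num.max a (Num.min b x))).
Proof.
move=> ab /real_ac_unif_cont uf x; apply/cvgrPdist_lt => e /uf[d d0 H].
near=> y; apply: H.
- by rewrite /= in_itv/= le_max lexx ge_max ab ge_min lexx.
- by rewrite /= in_itv/= le_max lexx ge_max ab ge_min lexx.
by apply: le_lt_trans (clamp_dist _ _ _ _) _; near: y; exact: cvgr_dist_lt.
Unshelve. all: by end_near. Qed.

Lemma nondecreasing_ac_primitive a b f : a <= b -> real_ac `[a, b] f ->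
  {in `[a, b] &, nondecreasing_fun f} ->
  exists2 g, mu.-integrable setT (EFin \o g) & forall x, a <= x <= b ->
    f x - f a = \int[mu]_(t in `]a, x]) g t.
Proof.
(* Projecting the argument extends [f] constantly beyond [a] and [b]; the extension is nondecreasing
   and continuous on the whole line, hence a cumulative function. *)
move=> ab acf ndf; pose G0 x := f (Num.max a (Num.min b x)).
have cl_in x : Num.max a (Num.min b x) \in `[a, b].
  by rewrite /= in_itv/= le_max lexx ge_max ab ge_min lexx.
have ndG : nondecreasing G0.
  by move=> x y xy; apply: ndf => //; exact: clamp_homo.
have rcG : forall x, G0 @ at_right x --> G0 x.
  by apply: right_continuousW; exact: real_ac_clamp_continuous.
pose G : cumulative R R := HB.pack G0 (isCumulative.Build R _ R G0 ndG rcG).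
have G0E x : a <= x <= b -> G0 x = f x.
  by move=> /andP[ax xb]; rewrite /G0 min_r// max_r.
have acG : real_ac `[a, b] G.
  by apply: real_ac_eq acf => x; rewrite inE/= in_itv/= => /G0E.
pose D : set (measurableTypeR R) := `]a, b]%classic.
have mD : measurable D by exact: measurable_itv.
have moo : (lebesgue_stieltjes_measure G D < +oo)%E.
  by rewrite lebesgue_stieltjes_measure_itvoc// ltry.
have [g [g0 gfin ig gE]] := radon_nikodym_sigma_finite
  (@lebesgue_stieltjes_dominates G a b D ab acG erefl mD moo).
have gK : EFin \o (fine \o g) = g by apply/funext => x /=; rewrite fineK.
exists (fine \o g); first by rewrite gK.
move=> x /andP[ax xb]; rewrite /Rintegral.
rewrite (_ : (\int[mu]_(t in `]a, x]) _)%E =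
  \int[mu]_(t in `]a, x]) g t)%E; last first.
  by apply: eq_integral => t _ /=; rewrite fineK.
rewrite -gE; last exact: measurable_itv.
change (f x - f a = fine (lebesgue_stieltjes_measure G (`]a, x]%classic `&` D))).
rewrite setIidl; last first.
  by move=> z; rewrite /D/= !in_itv/= => /andP[-> /le_trans]; apply.
by rewrite lebesgue_stieltjes_measure_itvoc//= !G0E// ?lexx ?ab// ax xb.
Qed.

Lemma real_ac_primitive a b f : a <= b -> real_ac `[a, b] f ->
  exists2 g, mu.-integrable setT (EFin \o g) & forall x, a <= x <= b ->
    f x - f a = \int[mu]_(t in `]a, x]) g t.
Proof.
move=> ab acf; pose V x := fine (total_variation a x f).
have acV : real_ac `[a, b] V := real_ac_total_variation ab acf.
have fin x y : x \in `[a, b] -> y \in `[a, b] -> x <= y ->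
    total_variation x y f \is a fin_num.
  move=> Iu Iv uv; rewrite ge0_fin_numE ?total_variation_ge0//.
  by apply: (real_ac_total_variation_lty acf) => //; exact: interval_is_interval.
have aI : a \in `[a, b] by rewrite in_itv/= lexx.
have VE x y : x \in `[a, b] -> y \in `[a, b] -> x <= y ->
    V y - V x = fine (total_variation x y f).
  move=> Ix Iy xy; have ax : a <= x by move: Ix; rewrite in_itv/= => /andP[].
  by rewrite /V (total_variationD _ ax xy) fineD ?fin// addrAC subrr add0r.
have [x y Ix Iy xy|gV igV gVE] := nondecreasing_ac_primitive ab acV.
  by rewrite -subr_ge0 VE// fine_ge0// total_variation_ge0.
have [x y Ix Iy xy|gP igP gPE] := nondecreasing_ac_primitive ab (real_acB acV acf).
  (* An increment of [f] is at most its variation, so [V - f] is nondecreasing. *)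
  have : f y - f x <= V y - V x.
    rewrite VE// (le_trans (ler_norm _))// -lee_fin fineK ?fin//.
    exact: total_variation_ge.
  by rewrite /=; lra.
exists (gV \- gP).
  rewrite [EFin \o _](_ : _ = ((EFin \o gV) \- (EFin \o gP))%E)//.
  exact: integrableB.
move=> x axb; rewrite RintegralB//=.
- by rewrite -gVE// -gPE//=; ring.
- exact: integrableS igV.
- exact: integrableS igP.
Qed.

Lemma real_ac_ftc a b f : a < b -> real_ac `]a, b[ f ->
  exists la lb g, [/\ f x @[x --> a^'+] --> la, f x @[x --> b^'-] --> lb,
    mu.-integrable setT (EFin \o g),
    {ae mu, forall x, a < x < b ->
      h^-1 * (f (h + x) - f x) @[h --> 0^'] --> g x} &
    \int[mu]_(x in `]a, b[) g x = lb - la].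
Proof.
move=> ab acf; have [F [acF Ff fa fb]] := real_ac_closure ab acf.
have [g ig gE] := real_ac_primitive (ltW ab) acF.
exists (F a), (F b), g; split => //; last first.
  rewrite Rintegral_itv_bndo_bndc; last exact: integrableS ig.
  by rewrite -gE// lexx ltW.
have ig' y : mu.-integrable [set` Interval (BRight a) (BRight y)] (EFin \o g).
  exact: integrableS ig.
have := FTC1 ig' (open_integrable_locally openT ig).
apply: filterS; first exact: (ae_filter_ringOfSetsType mu).
move=> x H /andP[ax xb].
have {H}[] := H ltac:(by rewrite lte_fin).
set P := fun y : R => _ => dP Pg.
have : h^-1 *: (P (h + x) - P x) @[h --> 0^'] --> g x.
  rewrite -Pg; move: dP; rewrite /derivable /derive1.
  by under eq_fun do rewrite /GRing.scale/= mulr1.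
apply: cvg_trans; apply: near_eq_cvg; near=> h.
have hx : a < h + x < b.
  have hs : `|h| < Num.min (x - a) (b - x).
    near: h; apply: dnbhs0_lt; by rewrite lt_min !subr_gt0 ax.
  move: hs; rewrite lt_min => /andP[].
  rewrite !ltr_norml => /andP[h1 h2] /andP[h3 h4].
  by apply/andP; split; lra.
(* [P] is the indefinite integral of [g] from [a]. On []a, b[] it differs from [f] by the constant
   [F a], so both have the same difference quotients for small [h]. *)
have Px y : a < y < b -> P y = f y - F a.
  by move=> /andP[ay yb]; rewrite -Ff ?in_itv/= ?ay// gE ?ltW//.
rewrite !Px ?ax//; rewrite /GRing.scale/=; congr (_ * _); ring.
Unshelve. all: by end_near. Qed.

End absolutely_continuous_primitive.

(** * Integrals up to null sets *)

Section integral_ae.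
Local Open Scope ereal_scope.
Context d (T : measurableType d) (R : realType).
Variable mu : {measure set T -> \bar R}.
Import HBNNSimple.

Let ge0_integral_ae_le (f g : T -> \bar R) : (forall x, 0 <= f x) ->
  (forall x, 0 <= g x) -> {ae mu, forall x, f x = g x} ->
  \int[mu]_x f x <= \int[mu]_x g x.
Proof.
move=> f0 g0 [N [mN N0 fgN]]; rewrite !ge0_integralTE//.
apply: ge_ereal_sup => _ [h hf <-].
have mNC : measurable (~` N) by exact: measurableC.
(* Multiplying [h] by the indicator of the complement of [N] puts it below [g] everywhere and keeps
   its integral. *)
apply: (@le_trans _ _ (sintegral mu (proj_nnsfun h mNC))); last first.
  apply: ereal_sup_ubound; exists (proj_nnsfun h mNC) => //= x.
  rewrite mindicE; have [xN|/negP xN] := boolP (x \in ~` N).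
    rewrite mulr1 (le_trans (hf x))// le_eqVlt; apply/orP; left; apply/eqP.
    by apply: contrapT => fgx; move: xN; rewrite inE; apply; exact: fgN.
  by rewrite mulr0.
rewrite -!integralT_nnsfun le_eqVlt; apply/orP; left; apply/eqP.
apply: ae_eq_integral => //.
- exact/measurable_EFinP.
- exact/measurable_EFinP.
- exists N; split => // x /=; apply: contra_notP => xN _.
  by rewrite mindicE mem_set// mulr1.
Qed.

(* No measurability is needed: the integral of a nonnegative function is a
   supremum over the simple functions below it, and those may be modified on
   a null set. *)
Lemma integral_ae_eq (f g : T -> \bar R) : {ae mu, forall x, f x = g x} ->
  \int[mu]_x f x = \int[mu]_x g x.
Proof.
have ge0_eq (f' g' : T -> \bar R) : (forall x, 0 <= f' x) ->
    (forall x, 0 <= g' x) -> {ae mu, forall x, f' x = g' x} ->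
    \int[mu]_x f' x = \int[mu]_x g' x.
  move=> f0 g0 fg; apply/eqP; rewrite eq_le !ge0_integral_ae_le//.
  by apply: filterS fg => x.
move=> fg; rewrite (integralE mu setT f) (integralE mu setT g); congr (_ - _).
  apply: ge0_eq; [exact: funepos_ge0|exact: funepos_ge0|].
  by apply: filterS fg => x E; rewrite !funeposE E.
apply: ge0_eq; [exact: funeneg_ge0|exact: funeneg_ge0|].
by apply: filterS fg => x E; rewrite !funenegE E.
Qed.

End integral_ae.

Section has_integral.
Context {R : realType}.
Implicit Types (f g h : R -> R) (v w : R).
Local Notation mu := (@lebesgue_measure R).

#[local] Instance ae_lebesgue_filter : Filter (nbhs (almost_everywhere mu)) :=
  ae_filter_ringOfSetsType mu.

(** A relation stable under changes on null sets: [f] is compared almost everywhere with an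
    integrable representative, because the derivatives integrated below are identified only almost
    everywhere. *)
Definition has_integral f v := exists g, [/\ mu.-integrable setT (EFin \o g),
  {ae mu, forall x, f x = g x} & v = \int[mu]_x g x].

Lemma has_integralE f v : has_integral f v -> \int[mu]_x f x = v.
Proof.
move=> [g [_ fg ->]]; rewrite /Rintegral; congr fine; apply: integral_ae_eq.
by apply: filterS fg => x ->.
Qed.

Lemma has_integral_unique f v w : has_integral f v -> has_integral f w -> v = w.
Proof. by move=> /has_integralE <- /has_integralE. Qed.

Lemma has_integral_ae f g v : {ae mu, forall x, f x = g x} ->
  has_integral f v -> has_integral g v.
Proof.
move=> fg [h [ih fh vE]]; exists h; split => //.
by apply: filterS2 fg fh => x -> ->.
Qed.

Lemma has_integral0 : has_integral (cst 0) 0.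
Proof.
exists (cst 0); split; [exact: integrable0|exact: aeW|].
by rewrite /Rintegral integral0.
Qed.

Lemma has_integralD f g v w : has_integral f v -> has_integral g w ->
  has_integral (f \+ g) (v + w).
Proof.
move=> [f' [if' ff' ->]] [g' [ig' gg' ->]]; exists (f' \+ g'); split.
- rewrite [EFin \o _](_ : _ = ((EFin \o f') \+ (EFin \o g'))%E)//.
  exact: integrableD.
- by apply: filterS2 ff' gg' => x /= -> ->.
- by rewrite RintegralD.
Qed.

Lemma has_integralM_bounded f v h (M : R) : has_integral f v ->
  measurable_fun setT h -> (forall x, `|h x| <= M) ->
  exists w, has_integral (f \* h) w.
Proof.
move=> [g [ig fg _]] mh hM; exists (\int[mu]_x (g \* h) x), (g \* h); split => //.
- rewrite [EFin \o _](_ : _ = ((EFin \o g) \* (EFin \o h))%E)//.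
  apply: integrableMl => //; exists M; split; first exact: num_real.
  by move=> r Mr x _; rewrite /= (le_trans (hM x))// ltW.
- by apply: filterS fg => x /= ->.
Qed.

Lemma has_integralZ f v (c : R) : has_integral f v ->
  has_integral (fun x => c * f x) (c * v).
Proof.
move=> [g [ig fg ->]]; exists (fun x => c * g x); split.
- rewrite [EFin \o _](_ : _ = (fun x => c%:E * (EFin \o g) x)%E)//.
  exact: integrableZl.
- by apply: filterS fg => x ->.
- by rewrite RintegralZl.
Qed.

(** The increments from [a] of the extension [F] to [[a, b]] are bounded by its finite total
    variation. *)
Lemma real_ac_bounded a b f : a < b -> real_ac `]a, b[ f ->
  exists M, forall x, a < x < b -> `|f x| <= M.
Proof.
move=> ab acf; have [F [acF Ff _ _]] := real_ac_closure ab acf.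
have aI : `[a, b]%classic a by rewrite /= in_itv/= lexx ltW.
have bI : `[a, b]%classic b by rewrite /= in_itv/= lexx ltW.
have TVfin : total_variation a b F \is a fin_num.
  rewrite ge0_fin_numE ?total_variation_ge0 ?ltW//.
  apply: (real_ac_total_variation_lty acF) => //; last exact: ltW.
  exact: interval_is_interval.
exists (`|F a| + fine (total_variation a b F)) => x /andP[ax xb].
rewrite -Ff ?in_itv/= ?ax// -[F x](subrKC (F a)) (le_trans (ler_normD _ _))// lerD2l.
rewrite -lee_fin fineK// (total_variationD _ (ltW ax) (ltW xb)).
rewrite (le_trans (total_variation_ge _ (ltW ax)))// leeDl//.
exact/total_variation_ge0/ltW.
Qed.

(** On []a, b[] the factor [h] agrees with [G], the constant continuation of its extension to
    [[a, b]]. Being continuous and bounded on the line, [G] is an admissible multiplier of an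
    integrable function. *)
Lemma has_integralM_ac a b f v h : a < b -> has_integral (f \_ `]a, b[) v ->
  real_ac `]a, b[ h -> exists w, has_integral ((f \* h) \_ `]a, b[) w.
Proof.
move=> ab fv ach; have [F [acF Ff _ _]] := real_ac_closure ab ach.
pose G x := F (Num.max a (Num.min b x)).
have cG : continuous G := real_ac_clamp_continuous (ltW ab) acF.
have [M FM] := real_ac_bounded ab ach.
have GM x : `|G x| <= Num.max M (Num.max `|F a| `|F b|).
  rewrite /G !le_max; have [bx|xb] := leP b x.
    by rewrite (max_r (ltW ab)) lexx !orbT.
  have [xa|ax] := leP x a; first by rewrite lexx !orbT.
  by rewrite Ff ?in_itv/= ?ax// FM// ax.
have [w fGw] := has_integralM_bounded fv (continuous_measurable_fun cG) GM.
exists w; apply: has_integral_ae fGw; apply: aeW => x; rewrite /= !patchE.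
case: ifPn => [|_]; last by rewrite mul0r.
rewrite inE/= in_itv/= => /andP[ax xb].
by rewrite /G min_r ?ltW// max_r ?ltW// Ff ?in_itv/= ?ax.
Qed.

End has_integral.

(** * Complex-valued functions *)

Section complex_limits.
Context {R : realType}.
Implicit Types (F G : R -> R[i]) (x : R) (l : R[i]).

Lemma cvg_real_complex {T : Type} {A : set_system T} {FA : Filter A}
    (f : T -> R) (l : R) : f x @[x --> A] --> l ->
  ((f x)%:C : R[i]^o) @[x --> A] --> (l%:C : R[i]^o).
Proof.
(* In [R[i]] every number above 0 is real, so [e] reduces to its real part. *)
move=> fl; apply/cvgrPdist_lt => e; rewrite ltcE/= => /andP[/eqP ie re].
move/cvgrPdist_lt: fl => /(_ _ re); apply: filterS => x xl.
rewrite -rmorphB normc_def/= expr0n addr0 sqrtr_sqr.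
by rewrite ltcE/= ie eqxx.
Qed.

Lemma cvg_complex {T : Type} {A : set_system T} {FA : Filter A}
    (f : T -> R[i]) l : complex.Re (f x) @[x --> A] --> complex.Re l ->
  complex.Im (f x) @[x --> A] --> complex.Im l ->
  (f x : R[i]^o) @[x --> A] --> (l : R[i]^o).
Proof.
move=> /cvg_real_complex fr /cvg_real_complex fi.
rewrite [l]complexE (_ : (fun t => _) =
    (fun t => (complex.Re (f t))%:C + 'i%C * (complex.Im (f t))%:C)).
  apply: (@cvgD _ R[i]^o); first exact: fr.
  by apply: (@cvgM R[i]); [exact: cvg_cst|exact: fi].
by apply/funext => t; exact: complexE.
Qed.

(** The relational form of [cderive1]: [lim] yields a value even for divergent quotients, so
    convergence is asserted here. *)
Definition is_cderive F x l :=
  ((h^-1)%:C * (F (h + x) - F x) : R[i]^o) @[h --> (0 : R)^'] --> (l : R[i]^o).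

Lemma is_cderiveE F x l : is_cderive F x l -> cderive1 F x = l.
Proof.
by move=> dF; apply: (@cvg_lim R[i]^o); [exact: norm_hausdorff|exact: dF].
Qed.

Lemma is_cderive_unique F x l l' :
  is_cderive F x l -> is_cderive F x l' -> l = l'.
Proof. by move=> /is_cderiveE <- /is_cderiveE. Qed.

(** For [h != 0], [F (h + x)] is [F x] plus [h] times a convergent difference quotient. *)
Lemma is_cderive_continuous F x l : is_cderive F x l ->
  (F (h + x) : R[i]^o) @[h --> (0 : R)^'] --> (F x : R[i]^o).
Proof.
move=> dF.
have : ((F x + h%:C * ((h^-1)%:C * (F (h + x) - F x))) : R[i]^o)
    @[h --> (0 : R)^'] --> (F x + 0%:C * l : R[i]^o).
  apply: (@cvgD _ R[i]^o); first exact: cvg_cst.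
  apply: (@cvgM R[i]) => //; apply: cvg_real_complex.
  by apply: cvg_within_filter; exact: cvg_id.
rewrite mul0r addr0; apply: cvg_trans; apply: near_eq_cvg; near=> h.
have h0 : h != 0 by near: h; exact: nbhs_dnbhs_neq.
by rewrite mulrA -rmorphM/= divff// mul1r subrKC.
Unshelve. all: by end_near. Qed.

Lemma is_cderiveM F G x l m : is_cderive F x l -> is_cderive G x m ->
  is_cderive (F \* G) x (l * G x + F x * m).
Proof.
move=> dF dG; have cG := is_cderive_continuous dG.
rewrite /is_cderive (_ : (fun h => _) =
    (fun h => ((h^-1)%:C * (F (h + x) - F x)) * G (h + x) +
              F x * ((h^-1)%:C * (G (h + x) - G x)))).
  apply: (@cvgD _ R[i]^o); apply: (@cvgM R[i]).
  - exact: dF.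
  - exact: cG.
  - exact: cvg_cst.
  - exact: dG.
by apply/funext => h /=; ring.
Qed.

(** The Leibniz rule, by induction on the list; [uniq s] ensures that the condition [j != k] removes
    exactly one factor. *)
Lemma is_cderive_prod (I : eqType) (s : seq I) (F : I -> R -> R[i]) (l : I -> R[i])
    x : uniq s -> (forall i, is_cderive (F i) x (l i)) ->
  is_cderive (fun y => \prod_(i <- s) F i y) x
    (\sum_(k <- s) l k * \prod_(j <- s | j != k) F j x).
Proof.
move=> + dF; elim: s => [_|i s IH /= /andP[iNs us]].
  rewrite big_nil /is_cderive; under eq_fun do rewrite !big_nil subrr mulr0.
  exact: cvg_cst.
have -> : (fun y => \prod_(j <- i :: s) F j y) =
    F i \* (fun y => \prod_(j <- s) F j y).
  by apply/funext => y; rewrite big_cons.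
have -> : \sum_(k <- i :: s) l k * \prod_(j <- i :: s | j != k) F j x =
    l i * \prod_(j <- s) F j x +
    F i x * \sum_(k <- s) l k * \prod_(j <- s | j != k) F j x.
  rewrite big_cons big_cons eqxx/= mulr_sumr; congr (_ * _ + _).
    rewrite big_seq_cond [RHS]big_seq; apply: eq_bigl => j.
    have [js|//] := boolP (j \in s); rewrite /=.
    by apply: contra iNs => /eqP <-.
  rewrite big_seq [RHS]big_seq; apply: eq_bigr => k ks.
  rewrite big_cons ifT; last by apply: contra iNs => /eqP ->.
  by rewrite mulrCA.
by apply: is_cderiveM => //; exact: IH.
Qed.

(** Substitution of [h / k] for [h] in the difference quotient. The derivative is found for the
    rescaled function, whereas the integrand involves that of [F] at [k * x]. *)
Lemma is_cderive_scale F (k x : R) l : 0 < k ->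
  is_cderive (fun y => F (k * y)) x l -> is_cderive F (k * x) ((k^-1)%:C * l).
Proof.
move=> k0 dF.
have hk : h / k @[h --> (0 : R)^'] --> (0 : R)^'.
  move=> A [e /= e0 eA]; exists (e * k); first by rewrite /= mulr_gt0.
  move=> h /= he h0; apply: eA => /=.
    by move: he; rewrite !sub0r !normrN normrM normfV (gtr0_norm k0) ltr_pdivrMr.
  by rewrite mulf_neq0// invr_neq0// gt_eqF.
rewrite /is_cderive (_ : (fun h => _) = (fun h => (k^-1)%:C *
    (((h / k)^-1)%:C * (F (k * (h / k + x)) - F (k * x))))).
  by apply: (@cvgM R[i]); [exact: cvg_cst|exact: (cvg_comp _ _ hk dF)].
apply/funext => h; have -> : k * (h / k + x) = h + k * x.
  by field; rewrite gt_eqF.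
by rewrite [RHS]mulrA -rmorphM/= invf_div mulrA mulVf ?gt_eqF// mul1r.
Qed.

End complex_limits.

(** * Integration of complex-valued functions and the fundamental theorem for products *)

Section complex_integral.
Context {R : realType}.
Implicit Types (F G : R -> R[i]) (D : set R) (v w : R[i]).
Local Notation mu := (@lebesgue_measure R).

#[local] Existing Instance ae_lebesgue_filter.

Definition crestrict D F x : R[i] := if x \in D then F x else 0.

Definition has_cintegral F v :=
  has_integral (fun x => complex.Re (F x)) (complex.Re v) /\
  has_integral (fun x => complex.Im (F x)) (complex.Im v).

Lemma has_cintegral_cintegral D F v :
  has_cintegral (crestrict D F) v -> cintegral D F = v.
Proof.
move=> [/has_integralE Fr /has_integralE Fi]; rewrite /cintegral.
case: v Fr Fi => vr vi /= <- <-; congr (_ +i* _).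
  rewrite Rintegral_mkcond; congr Rintegral.
  by apply/funext => x; rewrite patchE /crestrict; case: ifP.
rewrite Rintegral_mkcond; congr Rintegral.
by apply/funext => x; rewrite patchE /crestrict; case: ifP.
Qed.

Lemma has_cintegral_unique F v w :
  has_cintegral F v -> has_cintegral F w -> v = w.
Proof.
move=> [vr vi] [wr wi]; apply/eqP; rewrite eq_complex.
by rewrite (has_integral_unique vr wr) (has_integral_unique vi wi) !eqxx.
Qed.

Lemma has_cintegral_ae F G v : {ae mu, forall x, F x = G x} ->
  has_cintegral F v -> has_cintegral G v.
Proof.
move=> FG [vr vi]; split; [apply: has_integral_ae vr|apply: has_integral_ae vi];
  by apply: filterS FG => x ->.
Qed.

Lemma has_cintegral0 : has_cintegral (fun=> 0) 0.
Proof. by split; exact: has_integral0. Qed.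

Lemma has_cintegralD F G v w : has_cintegral F v -> has_cintegral G w ->
  has_cintegral (F \+ G) (v + w).
Proof.
move=> [vr vi] [wr wi]; split.
  rewrite (raddfD (@complex.Re R : Rcomplex R -> R)).
  apply: has_integral_ae (has_integralD vr wr); apply: aeW => x /=.
  by rewrite (raddfD (@complex.Re R : Rcomplex R -> R)).
rewrite (raddfD (@complex.Im R : Rcomplex R -> R)).
apply: has_integral_ae (has_integralD vi wi); apply: aeW => x /=.
by rewrite (raddfD (@complex.Im R : Rcomplex R -> R)).
Qed.

Lemma has_cintegral_sum (I : Type) (s : seq I) (F : I -> R -> R[i]) (v : I -> R[i]) :
  (forall i, has_cintegral (F i) (v i)) ->
  has_cintegral (fun x => \sum_(i <- s) F i x) (\sum_(i <- s) v i).
Proof.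
move=> Fv; elim: s => [|i s IH].
  by rewrite big_nil; under eq_fun do rewrite big_nil; exact: has_cintegral0.
rewrite big_cons; under eq_fun do rewrite big_cons.
exact: has_cintegralD.
Qed.

Lemma has_cintegralZ F v (c : R) : has_cintegral F v ->
  has_cintegral (fun x => c%:C * F x) (c%:C * v).
Proof.
move=> [/(has_integralZ c) vr /(has_integralZ c) vi].
have ReZ z : complex.Re (c%:C * z) = c * complex.Re z.
  by case: z => a b /=; rewrite mul0r subr0.
have ImZ z : complex.Im (c%:C * z) = c * complex.Im z.
  by case: z => a b /=; rewrite mul0r addr0.
by split; rewrite ?ReZ ?ImZ; under eq_fun do rewrite ?ReZ ?ImZ.
Qed.

Definition complex_ac D F := real_ac D (fun x => complex.Re (F x)) /\
  real_ac D (fun x => complex.Im (F x)).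

Lemma absolutely_continuous_on_complex_ac D F :
  absolutely_continuous_on D F -> complex_ac D F.
Proof.
(* Real and imaginary parts are handled together, as a map [p] compatible with subtraction and
   bounded by the modulus. *)
have key (p : R[i] -> R) : (forall z z', p z - p z' = p (z - z')) ->
    (forall z, `|p z| <= ComplexField.Normc.normc z) ->
    absolutely_continuous_on D F -> real_ac D (fun x => p (F x)).
  move=> pB pn acF e /acF[d d0 H]; exists d => // T x y Dxy dxy sd.
  have {}H := H #|T| (fun i => x (enum_val i)) (fun i => y (enum_val i)).
  apply: le_lt_trans (H _ _ _).
  - rewrite [leLHS](reindex (@enum_val T T))/=; last first.
      by apply: onW_bij; exact: enum_val_bij.
    by apply: ler_sum => i _; rewrite pB.
  - by move=> i; exact: Dxy.
  - by move=> i j _ _ /dxy => /(_ I I)/enum_val_inj.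
  - apply: le_lt_trans sd; rewrite [leRHS](reindex (@enum_val T T))//=.
    by apply: onW_bij; exact: enum_val_bij.
move=> acF; split; apply: key acF.
- by move=> [? ?] [? ?].
- by move=> [a b] /=; rewrite -sqrtr_sqr ler_wsqrtr// lerDl sqr_ge0.
- by move=> [? ?] [? ?].
- by move=> [a b] /=; rewrite -sqrtr_sqr ler_wsqrtr// lerDr sqr_ge0.
Qed.

Lemma complex_ac_affine (k c : R) D E F : 0 < k ->
  (forall x, E x -> D (k * x + c)) ->
  complex_ac D F -> complex_ac E (fun x => F (k * x + c)).
Proof.
move=> k0 ED [ar ai]; split.
  exact: (real_ac_affine (f := fun x => complex.Re (F x)) k0 ED).
exact: (real_ac_affine (f := fun x => complex.Im (F x)) k0 ED).
Qed.

Lemma complex_ac_eq D F G : {in D, F =1 G} -> complex_ac D F -> complex_ac D G.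
Proof.
by move=> FG [ar ai]; split; [apply: real_ac_eq ar|apply: real_ac_eq ai];
  move=> x /FG ->.
Qed.

Lemma complex_acM a b F G : a < b -> complex_ac `]a, b[ F ->
  complex_ac `]a, b[ G -> complex_ac `]a, b[ (F \* G).
Proof.
move=> ab [Fr Fi] [Gr Gi].
have acM f g : real_ac `]a, b[ f -> real_ac `]a, b[ g -> real_ac `]a, b[ (f \* g).
  move=> acf acg; have [M1 fM1] := real_ac_bounded ab acf.
  have [M2 gM2] := real_ac_bounded ab acg.
  by apply: (real_acM (M := Num.max M1 M2)) => // x;
    rewrite /= in_itv/= le_max => ?; rewrite ?fM1 ?gM2 ?orbT.
split.
  apply: real_ac_eq (real_acB (acM _ _ Fr Gr) (acM _ _ Fi Gi)) => x _ /=.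
  by case: (F x) (G x) => ? ? [].
apply: real_ac_eq (real_acD (acM _ _ Fr Gi) (acM _ _ Fi Gr)) => x _ /=.
by case: (F x) (G x) => ? ? [].
Qed.

Lemma complex_ac_prod (I : Type) (s : seq I) (P : pred I) (F : I -> R -> R[i]) a b :
  a < b -> (forall i, complex_ac `]a, b[ (F i)) ->
  complex_ac `]a, b[ (fun x => \prod_(i <- s | P i) F i x).
Proof.
move=> ab acF; elim: s => [|i s IH].
  apply: (@complex_ac_eq _ (fun=> 1)); first by move=> x _; rewrite big_nil.
  by split; exact: real_ac_cst.
have [Pi|Pi] := boolP (P i).
  apply: complex_ac_eq (complex_acM ab (acF i) IH) => x _ /=.
  by rewrite big_cons Pi.
by apply: complex_ac_eq IH => x _; rewrite big_cons (negbTE Pi).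
Qed.

Lemma complex_ac_ftc a b F : a < b -> complex_ac `]a, b[ F ->
  exists la lb g, [/\ (F x : R[i]^o) @[x --> a^'+] --> (la : R[i]^o),
    (F x : R[i]^o) @[x --> b^'-] --> (lb : R[i]^o),
    has_cintegral (crestrict `]a, b[ g) (lb - la) &
    {ae mu, forall x, a < x < b -> is_cderive F x (g x)}].
Proof.
move=> ab [/(real_ac_ftc ab)[ra [rb [gr [ra_ rb_ igr dr Ir]]]]
           /(real_ac_ftc ab)[ia [ib [gi [ia_ ib_ igi di Ii]]]]].
exists (ra +i* ia), (rb +i* ib), (fun x => gr x +i* gi x); split.
- exact: cvg_complex.
- exact: cvg_complex.
- have restr (g : R -> R) (v : R) : mu.-integrable setT (EFin \o g) ->
      \int[mu]_(x in `]a, b[) g x = v -> has_integral (g \_ `]a, b[) v.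
    move=> ig <-; exists (g \_ `]a, b[); split; last exact: Rintegral_mkcond.
      rewrite -restrict_EFin -integrable_mkcond; last exact: measurable_itv.
      exact: integrableS ig.
    exact: aeW.
  split.
    apply: has_integral_ae (restr _ _ igr Ir); apply: aeW => x.
    by rewrite patchE /crestrict; case: ifP.
  apply: has_integral_ae (restr _ _ igi Ii); apply: aeW => x.
  by rewrite patchE /crestrict; case: ifP.
- apply: filterS2 dr di => x /= dr di axb.
  rewrite /is_cderive; apply: cvg_complex.
    apply: cvg_trans (dr axb); apply: near_eq_cvg; near=> h.
    by case: (F (h + x)) (F x) => ? ? [? ?] /=; rewrite mul0r subr0.
  apply: cvg_trans (di axb); apply: near_eq_cvg; near=> h.
  by case: (F (h + x)) (F x) => ? ? [? ?] /=; rewrite mul0r addr0.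
Unshelve. all: by end_near. Qed.

Lemma has_cintegralM_ac a b F v G : a < b -> has_cintegral (crestrict `]a, b[ F) v ->
  complex_ac `]a, b[ G -> exists w, has_cintegral (crestrict `]a, b[ (F \* G)) w.
Proof.
move=> ab [Fr Fi] [Gr Gi].
pose fr x := complex.Re (F x); pose fi x := complex.Im (F x).
have {}Fr : has_integral (fr \_ `]a, b[) (complex.Re v).
  apply: has_integral_ae Fr; apply: aeW => x.
  by rewrite patchE /crestrict; case: ifP.
have {}Fi : has_integral (fi \_ `]a, b[) (complex.Im v).
  apply: has_integral_ae Fi; apply: aeW => x.
  by rewrite patchE /crestrict; case: ifP.
have [w1 H1] := has_integralM_ac ab Fr Gr; have [w2 H2] := has_integralM_ac ab Fi Gi.
have [w3 H3] := has_integralM_ac ab Fr Gi; have [w4 H4] := has_integralM_ac ab Fi Gr.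
exists ((w1 + (-1) * w2) +i* (w3 + w4)); split.
  apply: has_integral_ae (has_integralD H1 (has_integralZ (-1) H2)).
  apply: aeW => x; rewrite /= !patchE /crestrict.
  case: ifP => _; last by rewrite mulr0 addr0.
  by rewrite /= /fr /fi mulN1r; case: (F x) (G x) => ? ? [].
apply: has_integral_ae (has_integralD H3 H4).
apply: aeW => x; rewrite /= !patchE /crestrict.
case: ifP => _; last by rewrite addr0.
by rewrite /= /fr /fi; case: (F x) (G x) => ? ? [].
Qed.

(** The fundamental theorem is used for each factor and for the whole product. By the Leibniz rule
    the sum of the integrands is almost everywhere the derivative of the product, and uniqueness of
    the integral equates the values. *)
Lemma product_ftc (I : finType) (F : I -> R -> R[i]) (la lb : I -> R[i]) a b :
  a < b -> (forall i, complex_ac `]a, b[ (F i)) ->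
  (forall i, (F i x : R[i]^o) @[x --> a^'+] --> (la i : R[i]^o)) ->
  (forall i, (F i x : R[i]^o) @[x --> b^'-] --> (lb i : R[i]^o)) ->
  exists g : I -> R -> R[i], exists v : I -> R[i],
  [/\ {ae mu, forall x, a < x < b -> forall k, is_cderive (F k) x (g k x)},
      forall k, has_cintegral
        (crestrict `]a, b[ (fun x => g k x * \prod_(j | j != k) F j x)) (v k) &
      \sum_k v k = \prod_k lb k - \prod_k la k].
Proof.
move=> ab acF Fla Flb.
have /choice[g Hg] : forall k, exists g,
    (exists v, has_cintegral (crestrict `]a, b[ g) v) /\
    {ae mu, forall x, a < x < b -> is_cderive (F k) x (g x)}.
  move=> k; have [la' [lb' [g [_ _ Ig dg]]]] := complex_ac_ftc ab (acF k).
  by exists g; split => //; exists (lb' - la').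
have /choice[v Hv] : forall k, exists v, has_cintegral
        (crestrict `]a, b[ (fun x => g k x * \prod_(j | j != k) F j x)) v.
  move=> k; have [[w gw] _] := Hg k.
  exact: (has_cintegralM_ac ab gw (complex_ac_prod _ _ ab acF)).
have aeg : {ae mu, forall x, a < x < b -> forall k, is_cderive (F k) x (g k x)}.
  have := @filter_forall _ _ _ _ ae_lebesgue_filter (fun k => (Hg k).2).
  by move=> aeH; apply: filterS aeH => x H axb k; exact: H.
exists g, v; split => //.
have [pa [pb [G [Ga Gb IG dG]]]] :=
  complex_ac_ftc ab (complex_ac_prod (index_enum I) predT ab acF).
(* One-sided limits are unique, so the boundary values of the product are the products of the
   boundary values. *)
have -> : \prod_k lb k = pb.
  apply: (@cvg_unique _ (@norm_hausdorff _ R[i]^o) _ _ _ _ _ Gb).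
  exact: (@cvg_prodr _ _ _ R[i] I (index_enum I) predT F lb (fun i _ => Flb i)).
have -> : \prod_k la k = pa.
  apply: (@cvg_unique _ (@norm_hausdorff _ R[i]^o) _ _ _ _ _ Ga).
  exact: (@cvg_prodr _ _ _ R[i] I (index_enum I) predT F la (fun i _ => Fla i)).
apply: has_cintegral_unique IG.
apply: has_cintegral_ae (has_cintegral_sum (index_enum I) Hv).
apply: filterS2 aeg dG => x gx Gx.
rewrite /crestrict; case: ifPn => [|xab]; last first.
  exact: big1.
rewrite inE/= in_itv/= => axb.
apply: is_cderive_unique (Gx axb).
exact: (is_cderive_prod (index_enum_uniq I) (gx axb)).
Qed.

End complex_integral.

(** * Grid decomposition and jumps *)

Lemma big_nat_dvdn_mul (V : zmodType) (n d : nat) (F : nat -> V) : (0 < d)%N ->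
  \sum_(1 <= m < n * d | (d %| m)%N) F m = \sum_(1 <= i < n) F (i * d)%N.
Proof.
case: n => [|n] d0; first by rewrite mul0n !big_geq.
(* With the term of index 0 added to both sides, the range splits into full blocks of [d] indices,
   each having its first index as only multiple of [d]. *)
apply: (@addrI _ (F 0%N)).
have -> : F 0%N + \sum_(1 <= m < n.+1 * d | (d %| m)%N) F m =
    \sum_(0 <= m < n.+1 * d | (d %| m)%N) F m.
  by rewrite [RHS]big_ltn_cond ?muln_gt0// dvdn0.
rewrite -[F 0%N in RHS]/(F (0 * d)%N) -[RHS]big_ltn// big_mkcond big_nat_mul.
apply: eq_bigr => i _; rewrite big_ltn ?ltn_pmul2r// dvdn_mull//.
rewrite big_nat big1; first exact: addr0.
move=> m /andP[im mi]; rewrite ifF//; apply/negP => /dvdnP[q mq].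
by move: im mi; rewrite mq !ltn_pmul2r// ltnS => iq qi; rewrite ltnNge qi in iq.
Qed.

Section dedekind_reciprocity.
Context {R : realType}.
Local Notation mu := (@lebesgue_measure R).

#[local] Existing Instance ae_lebesgue_filter.

Lemma affine_cvg_at_right (k c p : R) : 0 < k ->
  k * x + c @[x --> p^'+] --> (k * p + c)^'+.
Proof.
move=> k0 A [e /= e0 eA]; exists (e / k); first by rewrite /= divr_gt0.
move=> x /= xe px; apply: eA => /=; last by rewrite ltrD2r ltr_pM2l.
rewrite opprD addrACA subrr addr0 -mulrBr normrM (gtr0_norm k0) mulrC.
by rewrite -ltr_pdivlMr.
Qed.

Lemma affine_cvg_at_left (k c p : R) : 0 < k ->
  k * x + c @[x --> p^'-] --> (k * p + c)^'-.
Proof.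
move=> k0 A [e /= e0 eA]; exists (e / k); first by rewrite /= divr_gt0.
move=> x /= xe px; apply: eA => /=; last by rewrite ltrD2r ltr_pM2l.
rewrite opprD addrACA subrr addr0 -mulrBr normrM (gtr0_norm k0) mulrC.
by rewrite -ltr_pdivlMr.
Qed.

Lemma ae_neq (c : R) : {ae mu, forall x, x != c}.
Proof.
exists [set c]; split; [exact: measurable_set1|exact: lebesgue_measure_set1|].
by move=> x /= /negP/negPn/eqP.
Qed.

(** The whole interval exceeds the two open pieces by at most the point [b], which is null. *)
Lemma has_cintegral_concat (a b c : R) (F : R -> R[i]) v w : a <= b <= c ->
  has_cintegral (crestrict `]a, b[ F) v -> has_cintegral (crestrict `]b, c[ F) w ->
  has_cintegral (crestrict `]a, c[ F) (v + w).
Proof.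
move=> /andP[ab bc] Fv Fw; apply: has_cintegral_ae (has_cintegralD Fv Fw).
apply: filterS (ae_neq b) => x xb; rewrite /= /crestrict !mem_setE !in_itv/=.
have [{}xb|bx|xb'] := ltgtP x b; last by rewrite xb' eqxx in xb.
  by rewrite andbT addr0 (lt_le_trans xb bc) andbT.
by rewrite andbF add0r (le_lt_trans ab bx).
Qed.

Lemma div_notin_int (m d : nat) : (0 < d)%N -> ~~ (d %| m)%N ->
  m%:R / d%:R \isn't a (@Num.int R).
Proof.
move=> d0 dm; apply: contra dm => /intrP[z /(congr1 (fun y => y * d%:R))].
rewrite divfK ?pnatr_eq0 ?gtn_eqF// -[m%:R]/((m%:Z)%:~R) -[d%:R]/((d%:Z)%:~R) -intrM.
by move=> /intr_inj mzd; apply/(@dvdzP d m); exists z.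
Qed.

(** * One-sided limits and absolute continuity of a rescaled function of class [S1] *)

Section S1_limits.
Variable f : R -> R[i].
Hypothesis f_S1 : S1 f.

Lemma S1_complex_ac : complex_ac `]0, 1[ f.
Proof. by have [_ _ /absolutely_continuous_on_complex_ac] := f_S1. Qed.

Lemma S1_periodic (n : nat) x : f (x + n%:R) = f x.
Proof. by have [pf _ _] := f_S1; rewrite periodicn. Qed.

Lemma S1_cvg_at_right (n : nat) :
  (f x : R[i]^o) @[x --> (n%:R : R)^'+] --> (right_lim0 f : R[i]^o).
Proof.
have [la [lb [g [fa _ _ _]]]] := complex_ac_ftc ltr01 S1_complex_ac.
have f0 : (f x : R[i]^o) @[x --> (0 : R)^'+] --> (right_lim0 f : R[i]^o).
  rewrite (_ : right_lim0 f = la)//.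
  by apply: (@cvg_lim R[i]^o); [exact: norm_hausdorff|exact: fa].
have := @affine_cvg_at_right 1 (- n%:R) n%:R ltr01; rewrite mul1r subrr => h.
have := cvg_comp _ _ h f0; apply: cvg_trans; apply: near_eq_cvg; near=> x.
by rewrite /= mul1r -[LHS](S1_periodic n) subrK.
Unshelve. all: by end_near. Qed.

Lemma S1_cvg_at_left (n : nat) :
  (f x : R[i]^o) @[x --> (n.+1%:R : R)^'-] --> (left_lim1 f : R[i]^o).
Proof.
have [la [lb [g [_ fb _ _]]]] := complex_ac_ftc ltr01 S1_complex_ac.
have f1 : (f x : R[i]^o) @[x --> (1 : R)^'-] --> (left_lim1 f : R[i]^o).
  rewrite (_ : left_lim1 f = lb)//.
  by apply: (@cvg_lim R[i]^o); [exact: norm_hausdorff|exact: fb].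
have := @affine_cvg_at_left 1 (- n%:R) n.+1%:R ltr01.
rewrite mul1r -natr1 addrAC subrr add0r natr1 => h.
have := cvg_comp _ _ h f1; apply: cvg_trans; apply: near_eq_cvg; near=> x.
by rewrite /= mul1r -[LHS](S1_periodic n) subrK.
Unshelve. all: by end_near. Qed.

(* The one-sided limits of f at m / d. *)
Definition S1_right (m d : nat) : R[i] :=
  if (d %| m)%N then right_lim0 f else f (m%:R / d%:R).

Definition S1_left (m d : nat) : R[i] :=
  if (d %| m)%N then left_lim1 f else f (m%:R / d%:R).

(** As [x] tends to [m / (k * d)], [k * x] tends to [m / d]. If [d] divides [m] this is an integer,
    where periodicity supplies the one-sided limit; otherwise [f] is continuous there. *)
Lemma S1_scale_cvg_at_right (k m d : nat) : (0 < k)%N -> (0 < d)%N ->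
  (f (k%:R * x) : R[i]^o) @[x --> (m%:R / (k * d)%:R : R)^'+] -->
  (S1_right m d : R[i]^o).
Proof.
move=> k0 d0; have k0' : 0 < k%:R :> R by rewrite ltr0n.
have := @affine_cvg_at_right k%:R 0 (m%:R / (k * d)%:R) k0'.
rewrite addr0.
have -> : k%:R * (m%:R / (k * d)%:R) = m%:R / d%:R :> R.
  by rewrite natrM; field; rewrite !pnatr_eq0 -!lt0n d0 k0.
under eq_fun do rewrite addr0.
suff fcv : (f x : R[i]^o) @[x --> (m%:R / d%:R : R)^'+] --> (S1_right m d : R[i]^o).
  by move=> h; exact: (cvg_comp _ _ h fcv).
rewrite /S1_right; have [/dvdnP[q ->]|dm] := boolP (d %| m)%N.
  rewrite natrM mulfK ?pnatr_eq0 -?lt0n//; exact: S1_cvg_at_right.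
have [_ cf _] := f_S1; apply: cvg_within_filter; exact: (cf _ (div_notin_int d0 dm)).
Qed.

Lemma S1_scale_cvg_at_left (k m d : nat) : (0 < k)%N -> (0 < d)%N -> (0 < m)%N ->
  (f (k%:R * x) : R[i]^o) @[x --> (m%:R / (k * d)%:R : R)^'-] -->
  (S1_left m d : R[i]^o).
Proof.
move=> k0 d0 m0; have k0' : 0 < k%:R :> R by rewrite ltr0n.
have := @affine_cvg_at_left k%:R 0 (m%:R / (k * d)%:R) k0'.
rewrite addr0.
have -> : k%:R * (m%:R / (k * d)%:R) = m%:R / d%:R :> R.
  by rewrite natrM; field; rewrite !pnatr_eq0 -!lt0n d0 k0.
under eq_fun do rewrite addr0.
suff fcv : (f x : R[i]^o) @[x --> (m%:R / d%:R : R)^'-] --> (S1_left m d : R[i]^o).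
  by move=> h; exact: (cvg_comp _ _ h fcv).
rewrite /S1_left; have [/dvdnP[[|q] mq]|dm] := boolP (d %| m)%N.
(* A zero quotient would give [m = 0]; a positive one has the successor form that [S1_cvg_at_left]
   expects. *)
- by rewrite mq mul0n in m0.
- by rewrite mq natrM mulfK ?pnatr_eq0 -?lt0n//; exact: S1_cvg_at_left.
have [_ cf _] := f_S1; apply: cvg_within_filter; exact: (cf _ (div_notin_int d0 dm)).
Qed.

(** On this grid cell [k * x] stays between [m / d] and [(m + 1) / d], hence between the consecutive
    integers [m %/ d] and [m %/ d + 1]; periodicity shifts it back to []0, 1[]. *)
Lemma S1_scale_ac (k m d : nat) : (0 < k)%N -> (0 < d)%N ->
  complex_ac `]m%:R / (k * d)%:R, m.+1%:R / (k * d)%:R[ (fun x => f (k%:R * x)).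
Proof.
move=> k0 d0; have k0' : 0 < k%:R :> R by rewrite ltr0n.
have d0' : 0 < d%:R :> R by rewrite ltr0n.
apply: (@complex_ac_eq _ _ (fun x => f (k%:R * x + (- (m %/ d)%:R)))).
  by move=> x _; rewrite -(S1_periodic (m %/ d)) subrK.
apply: complex_ac_affine S1_complex_ac => // x /=.
rewrite !in_itv/= natrM subr_gt0 ltrBlDr.
rewrite ltr_pdivrMr ?mulr_gt0// ltr_pdivlMr ?mulr_gt0// => /andP[h1 h2].
have m1 : (m %/ d)%:R * d%:R <= m%:R :> R by rewrite -natrM ler_nat leq_trunc_div.
have m2 : m.+1%:R <= (1 + (m %/ d)%:R) * d%:R :> R.
  by rewrite nat1r -natrM ler_nat ltn_ceil.
have kxd : k%:R * x * d%:R = x * (k%:R * d%:R) by ring.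
by apply/andP; split; rewrite -(ltr_pM2r d0') kxd;
  [exact: le_lt_trans h1|exact: lt_le_trans m2].
Qed.

End S1_limits.

(** * Summation over the grid and collection of the jumps *)

Section grid.
Variables (r : nat) (f : 'I_r.+1 -> R -> R[i]) (nu : 'I_r.+1 -> nat).
Hypothesis f_S1 : forall j, S1 (f j).
Hypothesis nu_gt0 : forall j, (0 < nu j)%N.
Hypothesis nu_coprime : forall i j, i != j -> coprime (nu i) (nu j).

Let N := (\prod_j nu j)%N.
(** This is [N / nu j]: at the grid point [m / N] the [j]-th argument is [m / M j], an integer
    exactly when [M j] divides [m]. *)
Let M j := (\prod_(i | i != j) nu i)%N.

Let NE j : N = (nu j * M j)%N.
Proof. by rewrite /N (bigD1 j). Qed.

Let N_gt0 : (0 < N)%N.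
Proof. by apply: prodn_gt0. Qed.

Let M_gt0 j : (0 < M j)%N.
Proof. by move: N_gt0; rewrite (NE j) muln_gt0 => /andP[]. Qed.

(** If [m = i * M k = i' * M j], multiplying by [nu j * nu k] and cancelling [N] gives
    [i * nu j = i' * nu k]. Coprimality makes [nu k] divide [i], whence [m >= nu k * M k = N], a
    contradiction. *)
Let M_dvd_uniq j k m : (0 < m < N)%N -> (M k %| m)%N -> j != k -> ~~ (M j %| m)%N.
Proof.
move=> /andP[m0 mN] /dvdnP[i mi] jk; apply/negP => /dvdnP[i' mi'].
have : (i * nu j = i' * nu k)%N.
  apply/eqP; rewrite -(eqn_pmul2r N_gt0); apply/eqP.
  rewrite {1}(NE k) (NE j) [LHS]mulnACA [RHS]mulnACA.
  rewrite -mulnA [(nu j * M k)%N]mulnC.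
  transitivity (m * (nu j * nu k))%N; first by rewrite mi; ring.
  by rewrite mi'; ring.
move=> ii'; have : (nu k %| i * nu j)%N by rewrite ii' dvdn_mull.
rewrite Gauss_dvdl; last by rewrite coprime_sym nu_coprime.
move=> /dvdn_leq ki; move: mN; rewrite (NE k) mi ltn_pmul2r// ltnNge ki//.
by move: m0; rewrite mi muln_gt0 => /andP[].
Qed.

Let term k x := cderive1 (f k) ((nu k)%:R * x) *
  \prod_(j < r.+1 | j != k) f j ((nu j)%:R * x).

(** [A m] and [B m] are the left and right limits at [m / N] of the product of the
    [f j (nu j * x)]. *)
Let A m := \prod_j S1_left (f j) m (M j).
Let B m := \prod_j S1_right (f j) m (M j).

Let piece m : exists v : 'I_r.+1 -> R[i],
  (forall k, has_cintegral
     (crestrict `]m%:R / N%:R, m.+1%:R / N%:R[ (term k)) (v k)) /\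
  \sum_k (nu k)%:R * v k = A m.+1 - B m.
Proof.
have pp : m%:R / N%:R < m.+1%:R / N%:R :> R.
  by rewrite ltr_pM2r ?invr_gt0 ?ltr0n// ltr_nat.
have [|j|j|g [v [aeg Iv sv]]] := @product_ftc R _ (fun j x => f j ((nu j)%:R * x))
  (fun j => S1_right (f j) m (M j)) (fun j => S1_left (f j) m.+1 (M j)) _ _ pp.
- by move=> j; rewrite (NE j); exact: S1_scale_ac.
- by rewrite (NE j); exact: S1_scale_cvg_at_right.
- by rewrite (NE j); exact: S1_scale_cvg_at_left.
(* Differentiating [f k (nu k * x)] produces a factor [nu k], which [term k] does not contain; the
   integral is divided by it. *)
exists (fun k => ((nu k)%:R^-1)%:C * v k); split; last first.
  rewrite -sv; apply: eq_bigr => k _; rewrite mulrA -(rmorph_nat (real_complex R)).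
  by rewrite -rmorphM divff ?pnatr_eq0 -?lt0n// mul1r.
move=> k; apply: has_cintegral_ae (has_cintegralZ ((nu k)%:R^-1) (Iv k)).
apply: filterS aeg => x gx; rewrite /crestrict; case: ifPn => [|_]; last first.
  by rewrite mulr0.
rewrite inE/= in_itv/= => /gx/(_ k) dk; rewrite /term mulrA; congr (_ * _).
by apply/esym/is_cderiveE; apply: is_cderive_scale => //; rewrite ltr0n.
Qed.

Lemma sum_cintegral_grid :
  \sum_k (nu k)%:R * cintegral `[0, 1] (term k) = \sum_(m < N) (A m.+1 - B m).
Proof.
have [v vP] := choice piece.
have step n k : has_cintegral (crestrict `]0, n%:R / N%:R[ (term k))
    (\sum_(m < n) v m k).
  elim: n => [|n IH].
    rewrite big_ord0 mul0r; apply: has_cintegral_ae has_cintegral0.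
    apply: aeW => x; rewrite /crestrict ifF// mem_setE in_itv/=.
    by apply/negP => /andP[x0 /(lt_trans x0)]; rewrite ltxx.
  rewrite big_ord_recr/=; apply: has_cintegral_concat IH _.
    by rewrite divr_ge0//= ler_pM2r ?invr_gt0 ?ltr0n// ler_nat.
  exact: (vP n).1.
have cE k : cintegral `[0, 1] (term k) = \sum_(m < N) v m k.
  apply: has_cintegral_cintegral; apply: has_cintegral_ae (step N k).
  rewrite divff ?pnatr_eq0 -?lt0n//.
  (* Passing from the open to the closed unit interval affects only the two endpoints, a null
     set. *)
  apply: filterS2 (ae_neq 0) (ae_neq 1) => x x0 x1; rewrite /crestrict.
  by rewrite !mem_setE !in_itv/= !lt_neqAle x1 [0 == x]eq_sym x0.
under eq_bigr do rewrite cE mulr_sumr.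
rewrite exchange_big/=; apply: eq_bigr => m _; exact: (vP m).2.
Qed.

(** If no [M k] divides [m], every factor is continuous and both sides vanish. Otherwise exactly one
    factor jumps, and the values of the others factor out of the difference. *)
Lemma grid_jump m : (0 < m < N)%N -> A m - B m =
  \sum_k if (M k %| m)%N then
    (\prod_(j | j != k) f j (m%:R / (M j)%:R)) * jump (f k) else 0.
Proof.
move=> mN; rewrite /A /B /S1_left /S1_right.
have [k Mk|M0] := pickP (fun k => M k %| m)%N; last first.
  rewrite [RHS]big1 => [|k _]; last by rewrite M0.
  by apply/eqP; rewrite subr_eq0; apply/eqP/eq_bigr => j _; rewrite M0.
have NM j : j != k -> (M j %| m)%N = false.
  by move=> jk; apply/negbTE; exact: M_dvd_uniq Mk jk.
rewrite (bigD1 k)//= Mk [X in _ - X](bigD1 k)//= Mk [RHS](bigD1 k)//= Mk.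
rewrite [X in _ = _ + X]big1 ?addr0; last by move=> j /NM ->.
rewrite (eq_bigr (fun j => f j (m%:R / (M j)%:R))); last by move=> j /NM ->.
rewrite [X in _ - _ * X](eq_bigr (fun j => f j (m%:R / (M j)%:R))); last first.
  by move=> j /NM ->.
by rewrite -mulrBl mulrC.
Qed.

Lemma sum_grid_jump : \sum_(m < N) (A m.+1 - B m) = jump_prod f + reciprocity f nu.
Proof.
(* Regrouping by grid points instead of cells isolates the two boundary terms and leaves the jumps
   at interior points. *)
have -> : \sum_(m < N) (A m.+1 - B m) =
    (A N - B 0%N) + \sum_(1 <= m < N) (A m - B m).
  rewrite -(big_mkord xpredT (fun m => A m.+1 - B m)) !sumrB.
  case: N N_gt0 => // n _; rewrite (big_nat_recr n)//= (big_nat_recl n 0)//=.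
  by rewrite -(big_add1 _ _ 0 n.+1 xpredT A) -(big_add1 _ _ 0 n.+1 xpredT B)/=; ring.
have AN : A N = \prod_j left_lim1 (f j).
  by apply: eq_bigr => j _; rewrite /S1_left {1}(NE j) dvdn_mull.
have B0 : B 0%N = \prod_j right_lim0 (f j).
  by apply: eq_bigr => j _; rewrite /S1_right dvdn0.
rewrite AN B0; congr (_ + _).
rewrite big_nat; under eq_bigr => m mN do rewrite grid_jump//.
rewrite -big_nat exchange_big/=; apply: eq_bigr => k _.
rewrite -big_mkcond/= -mulr_suml; congr (_ * _).
(* Since [N = nu k * M k], the multiples of [M k] strictly between 0 and [N] are the [i * M k] with
   [1 <= i < nu k]: the range of the Dedekind sum. *)
rewrite (NE k) big_nat_dvdn_mul// /dedekind_sum.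
apply: eq_bigr => i _; apply: eq_bigr => j jk; congr (f j _).
(* Both products equal [N], which turns the argument [i * M k / M j] into [i * nu j / nu k]. *)
have NR : (nu j)%:R * (M j)%:R = (nu k)%:R * (M k)%:R :> R by rewrite -!natrM -!NE.
have neq0 n : (0 < n)%N -> n%:R != 0 :> R by rewrite pnatr_eq0 lt0n.
apply: (mulIf (neq0 _ (M_gt0 j))); rewrite divfK ?neq0//.
rewrite !natrM.
have -> : i%:R * (nu j)%:R / (nu k)%:R * (M j)%:R =
    i%:R * ((nu j)%:R * (M j)%:R) / (nu k)%:R :> R by ring.
by rewrite NR; field; exact: neq0.
Qed.

End grid.

End dedekind_reciprocity.

Theorem theorem3p1 (R : realType) (r : nat) (f : 'I_r.+1 -> R -> R[i])
    (nu : 'I_r.+1 -> nat)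
    (r_ge1 : (1 <= r)%N)
    (f_S1 : forall j, S1 (f j))
    (nu_gt0 : forall j, (0 < nu j)%N)
    (nu_distinct : forall i j, i != j -> nu i != nu j)
    (nu_coprime : forall i j, i != j -> coprime (nu i) (nu j)) :
  reciprocity f nu =
    - jump_prod f +
    \sum_(k < r.+1) (nu k)%:R *
      cintegral `[0, 1] (fun x : R =>
        cderive1 (f k) ((nu k)%:R * x) *
        \prod_(j < r.+1 | j != k) f j ((nu j)%:R * x)).
Proof.
by rewrite (sum_cintegral_grid f_S1 nu_gt0) sum_grid_jump// addKr.
Qed.
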